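(* Let $r$ be a real number with $0<r\le 1$. Then for every integer $n\ge 1$, the function $f:\mathbb{R}^n\to\mathbb{R}$, $$f(x)=\frac{1-\|x\|}{1-\|x\|^r},$$ is conditionally negative definite on $\mathbb{R}^n$. As a consequence, for every integer $n\ge 1$ the function $g:\mathbb{R}^n\to\mathbb{R}$, $$g(x)=\frac{1-\|x\|^r}{1-\|x\|},$$ is infinitely divisible on $\mathbb{R}^n$.
   Context: $\|\cdot\|$ is the Euclidean norm on $\mathbb{R}^n$. Convention: when $\|x\|=1$, the quotients are interpreted as their limiting values, i.e. $f(x)=1/r$ and $g(x)=r$. Definitions. An $m\times m$ real symmetric matrix $A$ is positive semidefinite if $\langle v,Av\rangle\ge 0$ for all $v\in\mathbb{R}^m$; it is conditionally positive definite if $\langle v,Av\rangle\ge 0$ for all $v\in\mathbb{R}^m$ with $\sum_j v_j=0$; it is conditionally negative definite if $-A$ is conditionally positive definite. A continuous function $h:\mathbb{R}^n\to\mathbb{R}$ is called positive definite (resp. conditionally negative definite) if for every $m\ge 1$ and every choice of points $x_1,\dots,x_m\in\mathbb{R}^n$ the $m\times m$ matrix $[h(x_i-x_j)]$ is positive semidefinite (resp. conditionally negative definite). A nonnegative function $h$ on $\mathbb{R}^n$ is called infinitely divisible if for every real $\alpha>0$ the function $h(x)^\alpha$ is positive definite. *)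

(* Defs.v *)
From mathcomp Require Import all_boot all_order all_algebra.
From mathcomp Require Import all_classical all_reals all_analysis.

Set Implicit Arguments.
Unset Strict Implicit.
Unset Printing Implicit Defensive.

Import Order.TTheory GRing.Theory Num.Theory.
Import numFieldNormedType.Exports.

Local Open Scope classical_set_scope.
Local Open Scope ring_scope.

(* The library norm `|x| on 'rV[R]_n is the sup norm, hence this definition.
   Both norms induce the topology carried by 'rV[R]_n (product topology), so
   [continuous] below is continuity for the Euclidean topology. *)
Definition enorm (R : realType) (n : nat) (x : 'rV[R]_n) : R :=
  Num.sqrt (\sum_(i < n) x ord0 i ^+ 2).

Definition quad_form (R : realType) (m : nat) (A : 'M[R]_m) (v : 'cV[R]_m) : R :=
  (v^T *m (A *m v)) ord0 ord0.

Definition psd_mx (R : realType) (m : nat) (A : 'M[R]_m) : Prop :=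
  A^T = A /\ forall v : 'cV[R]_m, 0 <= quad_form A v.

Definition cond_posdef_mx (R : realType) (m : nat) (A : 'M[R]_m) : Prop :=
  A^T = A /\
  forall v : 'cV[R]_m, \sum_(j < m) v j ord0 = 0 -> 0 <= quad_form A v.

Definition cond_negdef_mx (R : realType) (m : nat) (A : 'M[R]_m) : Prop :=
  cond_posdef_mx (- A).

Definition diff_mx (R : realType) (n m : nat) (h : 'rV[R]_n -> R)
    (x : 'I_m -> 'rV[R]_n) : 'M[R]_m :=
  \matrix_(i < m, j < m) h (x i - x j).

Definition posdef_fun (R : realType) (n : nat) (h : 'rV[R]_n -> R) : Prop :=
  continuous h /\
  forall (m : nat) (x : 'I_m -> 'rV[R]_n), (1 <= m)%N -> psd_mx (diff_mx h x).

Definition cond_negdef_fun (R : realType) (n : nat) (h : 'rV[R]_n -> R) : Prop :=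
  continuous h /\
  forall (m : nat) (x : 'I_m -> 'rV[R]_n),
    (1 <= m)%N -> cond_negdef_mx (diff_mx h x).

Definition infinitely_divisible (R : realType) (n : nat)
    (h : 'rV[R]_n -> R) : Prop :=
  (forall x, 0 <= h x) /\
  forall alpha : R, 0 < alpha -> posdef_fun (fun x => h x `^ alpha).

(* On the unit sphere both quotients below take their limiting values. *)
Definition f_quot (R : realType) (r : R) (n : nat) (x : 'rV[R]_n) : R :=
  if enorm x == 1 then r^-1 else (1 - enorm x) / (1 - enorm x `^ r).

Definition g_quot (R : realType) (r : R) (n : nat) (x : 'rV[R]_n) : R :=
  if enorm x == 1 then r else (1 - enorm x `^ r) / (1 - enorm x).

(* Main.v *)
Require Import Defs.
From mathcomp Require Import all_boot all_order all_algebra.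
From mathcomp Require Import all_classical all_reals all_analysis.
From mathcomp Require Import ring lra.
Import Order.TTheory GRing.Theory Num.Theory.
Import numFieldNormedType.Exports.
Local Open Scope classical_set_scope.
Local Open Scope ring_scope.
Set Implicit Arguments.
Unset Strict Implicit.

(** The functions of [t] that send conditionally negative definite kernels to
    such kernels include those that have, at every large [T], an expansion
    [phi (T * (1 - z)) = q 0 + \sum_(k >= 1) q k * z ^+ k] on [`|z| < 1] with
    [q k <= 0] for [k >= 1]; a Bernstein function has this property. Indeed, up to
    a small perturbation, a conditionally negative definite kernel on a finite
    set is [T * (1 - E)] with [E] positive semidefinite and [`|E i j| < 1] once [T]
    is large; the entrywise powers of [E] are positive semidefinite by the Schur
    product theorem, and the constant [q 0] is invisible to vectors of sum zero
    ([cnd_bernstein]).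

    The binomial series shows that [t `^ r] has such expansions. With exponent
    [1/2], applied to the squared distance, this makes the Euclidean distance
    conditionally negative definite ([cnd_enorm]). It remains to expand
    [f = (1 - t) / (1 - t `^ r)]. Put [t = T * (1 - z)] with [1 < T], and let
    [w = 1 - T^-1] be the parameter of [t = 1]. Up to a positive factor, [1 / f]
    is the difference quotient of [1 - (1 - z) `^ r] between [w] and [z], and its
    coefficient of index [i] is [\sum_j b (i + j) * w ^+ j] with [b k] the
    coefficient of [z ^+ k.+1] in [1 - (1 - z) `^ r]. The ratios [b k.+1 / b k]
    are explicit and increasing, so [b] is log-convex, and the quotient inherits
    this ([quotc_logconvex]). A theorem of Kaluza says that the reciprocal of a
    power series with positive log-convex coefficients has nonpositive
    coefficients from index one on ([recip_le0]). Hence [f] of the distance is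
    conditionally negative definite.

    For the infinite divisibility of [g = 1 / f], a positive conditionally
    negative definite kernel [D] is, after a diagonal congruence, [1 - E] with [E]
    as above; since [(1 - z) `^ (- a)] has nonnegative coefficients for [0 < a],
    the kernel [D i j `^ (- a)] is positive semidefinite ([psd_powRN]). *)

(** * Kernels on a finite index set *)

Definition qform (R : realFieldType) (I : finType) (K : I -> I -> R)
    (v : I -> R) : R :=
  \sum_i \sum_j v i * v j * K i j.

Definition psd_kernel (R : realFieldType) (I : finType) (K : I -> I -> R) :=
  (forall i j, K i j = K j i) /\ forall v, 0 <= qform K v.

Definition cnd_kernel (R : realFieldType) (I : finType) (C : I -> I -> R) :=
  (forall i j, C i j = C j i) /\
  forall v, \sum_i v i = 0 -> qform C v <= 0.

Section Kernels.
Variables (R : realFieldType) (I : finType).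
Implicit Types (K A C : I -> I -> R) (u v : I -> R).

Lemma eq_qform K A v : (forall i j, K i j = A i j) -> qform K v = qform A v.
Proof.
by move=> e; apply: eq_bigr => i _; apply: eq_bigr => j _; rewrite e.
Qed.

Lemma qformD K A v : qform (fun i j => K i j + A i j) v = qform K v + qform A v.
Proof.
rewrite -big_split; apply: eq_bigr => i _ /=; rewrite -big_split.
by apply: eq_bigr => j _ /=; rewrite mulrDr.
Qed.

Lemma qformZ a K v : qform (fun i j => a * K i j) v = a * qform K v.
Proof.
rewrite mulr_sumr; apply: eq_bigr => i _; rewrite mulr_sumr.
by apply: eq_bigr => j _; rewrite mulrCA.
Qed.

Lemma qform_sum (J : Type) (s : seq J) (K : J -> I -> I -> R) v :
  qform (fun i j => \sum_(k <- s) K k i j) v = \sum_(k <- s) qform (K k) v.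
Proof.
rewrite exchange_big; apply: eq_bigr => i _; rewrite exchange_big.
by apply: eq_bigr => j _; rewrite mulr_sumr.
Qed.

Lemma qform_rank1 u v : qform (fun i j => u i * u j) v = (\sum_i v i * u i) ^+ 2.
Proof.
rewrite expr2 mulr_suml; apply: eq_bigr => i _; rewrite mulr_sumr.
by apply: eq_bigr => j _; ring.
Qed.

Lemma qform_cst (a : R) v : qform (fun _ _ => a) v = a * (\sum_i v i) ^+ 2.
Proof.
rewrite expr2 mulr_suml mulr_sumr; apply: eq_bigr => i _.
by rewrite !mulr_sumr; apply: eq_bigr => j _; ring.
Qed.

Lemma qform_diag K u v :
  qform (fun i j => u i * u j * K i j) v = qform K (fun i => u i * v i).
Proof. by apply: eq_bigr => i _; apply: eq_bigr => j _; ring. Qed.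

Lemma sum_delta n u : \sum_i (i == n)%:R * u i = u n.
Proof.
by rewrite (bigD1 n) //= eqxx mul1r big1 ?addr0 // => i /negPf->; rewrite mul0r.
Qed.

Lemma qform_shift K v n t : (forall i j, K i j = K j i) ->
  qform K (fun i => v i + t * (i == n)%:R) =
  qform K v + 2 * t * (\sum_i v i * K i n) + t ^+ 2 * K n n.
Proof.
move=> Ks.
have row i : \sum_j (v i + t * (i == n)%:R) * (v j + t * (j == n)%:R) * K i j =
    \sum_j v i * v j * K i j + t * (v i * K i n) +
    (i == n)%:R * (t * (\sum_j v j * K i j) + t ^+ 2 * K i n).
  have -> : \sum_j (v i + t * (i == n)%:R) * (v j + t * (j == n)%:R) * K i j =
     \sum_j ((v i * v j * K i j + (i == n)%:R * (t * (v j * K i j))) +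
      (j == n)%:R * (t * (v i * K i j) + (i == n)%:R * (t ^+ 2 * K i j))).
    by apply: eq_bigr => j _; ring.
  by rewrite !big_split /= sum_delta -!mulr_sumr; ring.
rewrite /qform; under eq_bigr do rewrite row.
rewrite !big_split /= sum_delta -mulr_sumr.
by under [X in _ + (t * X + _)]eq_bigr do rewrite Ks; ring.
Qed.

Lemma psd_diag_ge0 K n : psd_kernel K -> 0 <= K n n.
Proof.
move=> [Ks /(_ (fun i => 0 + 1 * (i == n)%:R))]; rewrite qform_shift //.
rewrite /qform big1 => [|i _]; last by rewrite big1 // => j _; rewrite !mul0r.
by rewrite big1 => [|i _]; rewrite ?mul0r // mulr0 !add0r expr1n mul1r.
Qed.

Lemma psd_pair K i j a b : psd_kernel K ->
  0 <= a ^+ 2 * K i i + 2 * (a * b) * K i j + b ^+ 2 * K j j.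
Proof.
move=> [Ks /(_ (fun k => (0 + a * (k == i)%:R) + b * (k == j)%:R))].
rewrite !qform_shift // /qform.
rewrite big1 => [|k _]; last by rewrite big1 // => l _; rewrite !mul0r.
rewrite big1 => [|k _]; last by rewrite mul0r.
under eq_bigr do rewrite add0r -mulrA mulrCA.
rewrite sum_delta mulr0 !add0r => h.
by apply: le_trans h _; rewrite le_eqVlt; apply/orP; left; apply/eqP; ring.
Qed.

(** Otherwise the form would be affine and nonconstant along the coordinate [n]. *)
Lemma psd_row0 K n j : psd_kernel K -> K n n = 0 -> K n j = 0.
Proof.
move=> Kp Kn; apply/eqP; apply: contraT => nz.
have := psd_pair n j (- (K j j + 1) / (2 * K n j)) 1 Kp.
rewrite Kn mulr0 add0r mulr1 expr1n mul1r.
suff -> : 2 * (- (K j j + 1) / (2 * K n j)) * K n j + K j j = -1 by rewrite ler0N1.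
by field.
Qed.

(** Completing the square in the coordinate [n]: the new form at [v] is the old
    one at the shift of [v] along [n] that minimizes it. *)
Lemma psd_schur_complement K n : psd_kernel K -> 0 < K n n ->
  psd_kernel (fun i j => K i j - K i n * K j n / K n n).
Proof.
move=> [Ks Kp] Kn; split=> [i j|v]; first by rewrite Ks (mulrC (K i n)).
set s := \sum_i v i * K i n.
rewrite (_ : qform _ v = qform K (fun i => v i + - (s / K n n) * (i == n)%:R)) //.
rewrite qform_shift // -/s.
rewrite (@eq_qform _ (fun i j => K i j + (- (K n n)^-1) * (K i n * K j n))); last first.
  by move=> i j; ring.
by rewrite qformD qformZ qform_rank1 -/s; field; rewrite gt_eqF.
Qed.

(** Rank-one kernels are peeled off [K] one coordinate at a time; the product of
    [A] with a rank-one kernel is [A] conjugated by a diagonal matrix. *)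
Lemma psd_schur_product A K : psd_kernel A -> psd_kernel K ->
  psd_kernel (fun i j => A i j * K i j).
Proof.
move=> [As Ap] Kp; split=> [i j|v]; first by rewrite As (proj1 Kp).
(* [s] lists the coordinates whose rows may still be nonzero. *)
suff peel (s : seq I) : forall K, psd_kernel K -> (forall i j, i \notin s -> K i j = 0) ->
    0 <= qform (fun i j => A i j * K i j) v.
  by apply: (peel (enum I) K Kp) => i j; rewrite mem_enum.
elim: s => [|n s IH] {Kp}K Kp K0.
  rewrite /qform big1 // => i _; rewrite big1 // => j _.
  by rewrite K0 // !mulr0.
have [Kn0|Kn0] := eqVneq (K n n) 0.
  apply: IH => // i j; have [-> _|ni iS] := eqVneq i n; first exact: psd_row0.
  by apply: K0; rewrite inE negb_or ni.
have Kn : 0 < K n n by rewrite lt_def Kn0 psd_diag_ge0.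
rewrite (@eq_qform _ (fun i j => A i j * (K i j - K i n * K j n / K n n) +
    (K n n)^-1 * (K i n * K j n * A i j))); last by move=> i j; ring.
rewrite qformD qformZ qform_diag addr_ge0 ?mulr_ge0 ?invr_ge0 ?(ltW Kn) //.
apply: IH; first exact: psd_schur_complement.
move=> i j; have [-> _|ni iS] := eqVneq i n.
  by rewrite mulrAC mulfV // mul1r (proj1 Kp) subrr.
have i0 l : K i l = 0 by apply: K0; rewrite inE negb_or ni.
by rewrite !i0 !mul0r subr0.
Qed.

Lemma psd_cst (a : R) : 0 <= a -> psd_kernel (fun _ _ : I => a).
Proof.
move=> a0; split=> // v.
by rewrite qform_cst mulr_ge0 ?sqr_ge0.
Qed.

Lemma psd_exp K k : psd_kernel K -> psd_kernel (fun i j => K i j ^+ k).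
Proof.
move=> Kp; elim: k => [|k IH]; first exact: psd_cst.
have [s p] := psd_schur_product Kp IH.
by split=> [i j|v]; [rewrite (proj1 Kp)|under eq_qform do rewrite exprS].
Qed.

(** Test vectors supported on [i] and [j] bound the entry by the diagonal. *)
Lemma psd_lt1 K : psd_kernel K -> (forall i, K i i < 1) ->
  forall i j, `|K i j| < 1.
Proof.
move=> Kp K1 i j; have := psd_pair i j 1 1 Kp; have := psd_pair i j 1 (-1) Kp.
have := K1 i; have := K1 j; rewrite ltr_norml => *; apply/andP; lra.
Qed.

End Kernels.

(** * Power series applied to kernels *)

Section Transfer.
Variables (R : realType) (I : finType).
Implicit Types (E C L : I -> I -> R) (v : I -> R) (q : nat -> R).

Lemma cvg_qform (F : nat -> I -> I -> R) L v :
  (forall i j, (fun n => F n i j) @ \oo --> L i j) ->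
  (fun n => qform (F n) v) @ \oo --> qform L v.
Proof.
move=> FL; apply: cvg_big => [|i _]; first exact: add_continuous.
apply: cvg_big => [|j _]; first exact: add_continuous.
by apply: cvgM; [exact: cvg_cst|exact: FL].
Qed.

Lemma qform_series q E v n :
  qform (fun i j => series (fun k => q k * E i j ^+ k) n) v =
  series (fun k => q k * qform (fun i j => E i j ^+ k) v) n.
Proof. by rewrite qform_sum; apply: eq_bigr => k _; rewrite qformZ. Qed.

Lemma psd_series q E L : psd_kernel E -> (forall k, 0 <= q k) ->
  (forall i j, series (fun k => q k * E i j ^+ k) @ \oo --> L i j) ->
  forall v, 0 <= qform L v.
Proof.
pose Sn n i j := series (fun k => q k * E i j ^+ k) n.
move=> Ep q0 qL v; have c : (fun n => qform (Sn n) v) @ \oo --> qform L v by exact: cvg_qform.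
apply: (cvgr_to_ge c).
apply: nearW => n; rewrite qform_series; apply: sumr_ge0 => k _.
by rewrite mulr_ge0 //; exact: (proj2 (psd_exp k Ep)).
Qed.

(** The constant coefficient is free, because a constant kernel vanishes on the
    vectors of sum zero. *)
Lemma cnd_series q E L : psd_kernel E -> (forall k, q k.+1 <= 0) ->
  (forall i j, series (fun k => q k * E i j ^+ k) @ \oo --> L i j) ->
  forall v, \sum_i v i = 0 -> qform L v <= 0.
Proof.
pose Sn n i j := series (fun k => q k * E i j ^+ k) n.
move=> Ep q0 qL v v0; have c : (fun n => qform (Sn n) v) @ \oo --> qform L v by exact: cvg_qform.
apply: (cvgr_to_le c).
apply: nearW => n; rewrite qform_series; apply: sumr_le0 => -[|k] _.
  by rewrite (qform_cst 1) v0 expr0n !mulr0.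
by rewrite mulr_le0_ge0 //; exact: (proj2 (psd_exp _ Ep)).
Qed.

(** A conditionally negative definite kernel with a strict margin [e] is a
    constant minus a positive semidefinite kernel. With [s] the sum of [v], the
    vector [v] minus [s] times a basis vector has sum zero; the cross terms
    [s * v i * C i i0] are absorbed by [e * v i ^+ 2] and by [T * s ^+ 2]. *)
Lemma cnd_domination C (i0 : I) (e : R) : cnd_kernel C -> 0 <= C i0 i0 -> 0 < e ->
  exists T0 : R, forall T : R, T0 <= T ->
    psd_kernel (fun i j => T - (C i j + 2 * e - e * (i == j)%:R)).
Proof.
move=> [Cs Cn] C0 e0; exists (2 * e + \sum_i C i i0 ^+ 2 / e) => T hT.
split=> [i j|v]; first by rewrite Cs (eq_sym i).
have qd : qform (fun i j : I => (i == j)%:R) v = \sum_i v i ^+ 2.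
  apply: eq_bigr => i _; rewrite (bigD1 i) //= eqxx mulr1 big1 ?addr0 ?expr2 //.
  by move=> j ji; rewrite eq_sym (negPf ji) mulr0.
have -> : qform (fun i j => T - (C i j + 2 * e - e * (i == j)%:R)) v =
    (T - 2 * e) * (\sum_i v i) ^+ 2 - qform C v + e * \sum_i v i ^+ 2.
  rewrite (@eq_qform _ _ _ (fun i j => (T - 2 * e) + (-1) * C i j +
    e * (i == j)%:R)); last by move=> i j; ring.
  by rewrite !qformD !qformZ qd !qform_cst; ring.
set s := \sum_i v i.
have := Cn (fun i => v i + (- s) * (i == i0)%:R).
rewrite qform_shift // big_split /= -mulr_sumr.
under [X in _ + (- s) * X]eq_bigr do rewrite -[_%:R]mulr1.
rewrite (sum_delta i0 (fun=> 1)) mulr1 -/s subrr => /(_ erefl) qv.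
have cross : 2 * s * (\sum_i v i * C i i0) <=
    e * (\sum_i v i ^+ 2) + s ^+ 2 * \sum_i C i i0 ^+ 2 / e.
  rewrite [leLHS]mulr_sumr [X in _ <= X + _]mulr_sumr [X in _ <= _ + X]mulr_sumr.
  rewrite -big_split; apply: ler_sum => i _ /=.
  rewrite -subr_ge0.
  have -> : e * v i ^+ 2 + s ^+ 2 * (C i i0 ^+ 2 / e) - 2 * s * (v i * C i i0) =
     e * (v i - s * C i i0 / e) ^+ 2 by field; rewrite gt_eqF.
  by rewrite mulr_ge0 ?sqr_ge0 ?ltW.
have hs : (2 * e + \sum_i C i i0 ^+ 2 / e) * s ^+ 2 <= T * s ^+ 2.
  by rewrite ler_wpM2r ?sqr_ge0.
have := mulr_ge0 (sqr_ge0 s) C0; nra.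
Qed.

(** For [t = T * (1 - z)] this says that the Taylor coefficients of [phi] at [T]
    have the signs that they have for a Bernstein function. *)
Definition bernstein_at (phi : R -> R) (T : R) :=
  exists q, (forall k, q k.+1 <= 0) /\
    forall z, `|z| < 1 -> series (fun k => q k * z ^+ k) @ \oo --> phi (T * (1 - z)).

(** After adding to [C] a kernel that is small and strictly conditionally negative
    definite, [C = T * (1 - E)] with [E] positive semidefinite and with entries
    in the open unit disc, and the expansion of [phi] at [T] applies. *)
Lemma cnd_bernstein (phi : R -> R) (T0 : R) C (i0 : I) :
  continuous phi -> (forall T, T0 < T -> bernstein_at phi T) ->
  cnd_kernel C -> (forall i j, 0 <= C i j) ->
  cnd_kernel (fun i j => phi (C i j)).
Proof.
move=> cphi phiB Cn C0; split=> [i j|v v0]; first by rewrite (proj1 Cn).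
pose D (e : R) i j := C i j + 2 * e - e * (i == j)%:R.
have Dle e : 0 < e -> qform (fun i j => phi (D e i j)) v <= 0.
  move=> e0; have [T1 psdT] := cnd_domination (i0 := i0) Cn (C0 _ _) e0.
  pose T := Num.max 1 (Num.max (T0 + 1) T1).
  have [T_ge1 [T_gt0 T_ge]] : 1 <= T /\ T0 < T /\ T1 <= T.
    split; first by rewrite le_max lexx.
    split; last by rewrite !le_max lexx !orbT.
    by rewrite !lt_max ltrDl ltr01 orbT.
  have Tn0 : T != 0 by rewrite gt_eqF // (lt_le_trans ltr01).
  have [q [q0 qcvg]] := phiB _ T_gt0.
  pose E i j := T^-1 * (T - D e i j).
  have Ep : psd_kernel E.
    have [s p] := psdT _ T_ge; split=> [i j|u]; first by rewrite /E s.
    by rewrite qformZ mulr_ge0 ?p // invr_ge0 (le_trans ler01).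
  have E1 i : E i i < 1.
    rewrite /E ltr_pdivrMl ?(lt_le_trans ltr01) // mulr1 /D eqxx mulr1.
    by have := C0 i i; lra.
  apply: (@cnd_series q E) => // i j.
  have -> : D e i j = T * (1 - E i j) by rewrite /E; field.
  exact/qcvg/psd_lt1.
have cvgD : (fun n => qform (fun i j => phi (D (harmonic n) i j)) v) @ \oo -->
    qform (fun i j => phi (C i j)) v.
  apply: cvg_qform => i j; apply: continuous_cvg; first exact: cphi.
  have -> : C i j = C i j + 2 * 0 - 0 * (i == j)%:R by ring.
  rewrite /D; apply: cvgB; last by apply: cvgMr_tmp; exact: cvg_harmonic.
  by apply: cvgD; [exact: cvg_cst|apply: cvgMl_tmp; exact: cvg_harmonic].
by apply: (cvgr_to_le cvgD); apply: nearW => n; apply: Dle; rewrite harmonic_gt0.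
Qed.

End Transfer.

(** * The binomial series *)

Section Binomial.
Variable R : realType.
Implicit Types (c : nat -> R) (a z s : R).

(** Radius of convergence at least one. This form, unlike boundedness of [c], is
    inherited by the coefficients of the derivative. *)
Definition disc_bounded c :=
  forall s, 0 < s < 1 -> exists M, forall n, `|c n| * s ^+ n <= M.

(** Any radius [s < 1] is at most the square of a radius [u < 1]; of the two factors
    [u ^+ n] of [s ^+ n], one compensates the coefficients and the other is left
    for convergence. *)
Lemma sqr_mid_ge s : s <= ((1 + s) / 2) ^+ 2.
Proof. by have := sqr_ge0 (1 - s); lra. Qed.

Lemma succ_mul_expr_bounded s n : 0 < s < 1 -> n.+1%:R * s ^+ n <= (1 - s)^-1.
Proof.
move=> /andP[s0 s1]; rewrite -[leRHS]mul1r ler_pdivlMr ?subr_gt0 //.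
apply: (@le_trans _ _ ((\sum_(i < n.+1) s ^+ i) * (1 - s))).
  have -> : n.+1%:R * s ^+ n = \sum_(i < n.+1) s ^+ n.
    by rewrite sumr_const card_ord mulr_natl.
  rewrite ler_wpM2r ?subr_ge0 ?(ltW s1) //.
  by apply: ler_sum => i _; apply: ler_wiXn2l; rewrite ?ltW // -ltnS.
rewrite mulrC -opprB mulNr -subrX1 opprB.
by rewrite lerBlDr lerDl exprn_ge0 // ltW.
Qed.

Lemma disc_bounded_diffs c : disc_bounded c -> disc_bounded (pseries_diffs c).
Proof.
move=> cb s /andP[s0 s1].
have w01 : 0 < (1 + s) / 2 < 1 by apply/andP; split; lra.
have := sqr_mid_ge s; set w := (1 + s) / 2 in w01 *; move=> sw.
have [M cM] := cb w w01; have /andP[w0 w1] := w01.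
exists ((1 - w)^-1 * (M / w)) => n.
apply: (@le_trans _ _ ((n.+1%:R * w ^+ n) * (`|c n.+1| * w ^+ n.+1 / w))).
  have -> : (n.+1%:R * w ^+ n) * (`|c n.+1| * w ^+ n.+1 / w) =
      `|pseries_diffs c n| * (w ^+ 2) ^+ n.
    rewrite /pseries_diffs normrM ger0_norm // -exprM mulnC exprM exprS.
    by field; rewrite gt_eqF.
  by rewrite ler_wpM2l // lerXn2r // nnegrE ?sqr_ge0 ?(ltW s0).
apply: ler_pM; rewrite ?mulr_ge0 ?invr_ge0 ?exprn_ge0 ?(ltW w0) //.
  exact: succ_mul_expr_bounded.
by rewrite ler_wpM2r // invr_ge0 ltW.
Qed.

Lemma disc_bounded_norm_cvg c z : disc_bounded c -> `|z| < 1 ->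
  cvgn (series (fun n => `|c n| * `|z| ^+ n)).
Proof.
move=> cb z1; have z0 := normr_ge0 z.
have w01 : 0 < (1 + `|z|) / 2 < 1 by apply/andP; split; lra.
have := sqr_mid_ge `|z|; set w := (1 + `|z|) / 2 in w01 *; move=> zw.
have [M cM] := cb w w01; have /andP[w0 w1] := w01.
have M0 : 0 <= M by apply: le_trans (cM 0); rewrite mulr_ge0.
apply: (@series_le_cvg _ _ (geometric M w)) => [n|n|n|].
- by rewrite mulr_ge0 ?exprn_ge0.
- by rewrite mulr_ge0 ?exprn_ge0 // ltW.
- apply: (@le_trans _ _ (`|c n| * w ^+ n * w ^+ n)); last first.
    by rewrite ler_wpM2r // exprn_ge0 // ltW.
  rewrite -mulrA -exprMn -expr2 ler_wpM2l //.
  by rewrite lerXn2r // nnegrE sqr_ge0.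
- by apply: is_cvg_geometric_series; rewrite gtr0_norm.
Qed.

Lemma disc_bounded_cvg c z : disc_bounded c -> `|z| < 1 -> cvgn (pseries c z).
Proof.
move=> cb /(disc_bounded_norm_cvg cb); under eq_fun do rewrite -normrX -normrM.
exact: normed_cvg.
Qed.

Lemma disc_bounded_derive c z : disc_bounded c -> `|z| < 1 ->
  is_derive z (1 : R) (fun x => limn (pseries c x)) (limn (pseries (pseries_diffs c) z)).
Proof.
move=> cb z1; have z0 := normr_ge0 z.
have w1 : `|(1 + `|z|) / 2| < 1 by rewrite ger0_norm; lra.
have db := disc_bounded_diffs cb; have ddb := disc_bounded_diffs db.
apply: (@pseries_snd_diffs _ _ ((1 + `|z|) / 2)); try exact: disc_bounded_cvg.
by rewrite [ltRHS]ger0_norm; lra.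
Qed.

Lemma disc_bounded_ratio c :
  (forall s, 0 < s < 1 -> exists N, forall k, (N <= k)%N -> `|c k.+1| * s <= `|c k|) ->
  disc_bounded c.
Proof.
move=> cr s s01; have /andP[s0 s1] := s01; have [N cN] := cr s s01.
have t0 k : 0 <= `|c k| * s ^+ k by rewrite mulr_ge0 ?exprn_ge0 // ltW.
have start k : (k <= N)%N -> `|c k| * s ^+ k <= \sum_(i < N.+1) `|c i| * s ^+ i.
  move=> kN; rewrite (bigD1 (inord k)) //= inordK // lerDl.
  by apply: sumr_ge0.
exists (\sum_(i < N.+1) `|c i| * s ^+ i) => n.
have [/ltnW/start//|/subnK <-] := ltnP n N.
elim: (n - N)%N => [|k IH]; first exact: start.
apply: le_trans IH; rewrite addSn exprS mulrA ler_wpM2r ?exprn_ge0 ?(ltW s0) //.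
by apply: cN; rewrite leq_addl.
Qed.

(** The coefficients of [(1 - z) `^ a]. *)
Fixpoint binc a k : R :=
  if k is k'.+1 then binc a k' * (k'%:R - a) / k'.+1%:R else 1.
Arguments binc : simpl never.

Lemma bincE a k : binc a k.+1 = binc a k * (k%:R - a) / k.+1%:R.
Proof. by []. Qed.

Lemma bincS a k : k.+1%:R * binc a k.+1 = (k%:R - a) * binc a k.
Proof. by rewrite bincE; field. Qed.

(** The ratio of consecutive coefficients tends to one. *)
Lemma binc_disc_bounded a : disc_bounded (binc a).
Proof.
apply: disc_bounded_ratio => s /andP[s0 s1].
have e0 : 0 < 1 - s by rewrite subr_gt0.
(* From this index on, [(k%:R + `|a|) * s <= k.+1%:R]. *)
exists (Num.bound (`|a| / (1 - s))) => k hk.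
have ak : `|a| <= k%:R * (1 - s).
  rewrite -ler_pdivrMr // ltW // (lt_le_trans (archi_boundP _)) ?ler_nat //.
  by rewrite divr_ge0 // ltW.
rewrite bincE !normrM normfV -!mulrA ler_piMr // [`|k.+1%:R|]ger0_norm //.
rewrite mulrCA ler_pdivrMl // mulr1.
have := ler_normB k%:R a; rewrite [`|k%:R|]ger0_norm //.
have k0 : 0 <= k%:R :> R by [].
rewrite -[k.+1]addn1 natrD => h.
have := ler_wpM2r (ltW s0) h; have := normr_ge0 a; nra.
Qed.

Lemma disc_derive0_cst (f : R -> R) z :
  (forall x : R, `|x| < 1 -> is_derive x (1 : R) f 0) -> `|z| < 1 -> f z = f 0.
Proof.
move=> fd z1.
have fc (x : R) : `|x| < 1 -> {for x, continuous f}.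
  by move=> /fd dx; apply/differentiable_continuous/derivable1_diffP; apply: ex_derive.
have fe (u v : R) : `|u| < 1 -> `|v| < 1 -> u <= v -> f v = f u.
  rewrite !ltr_norml => /andP[u0 u1] /andP[v0 v1] uv.
  have xin x : u <= x <= v -> `|x| < 1.
    by move=> /andP[ux xv]; rewrite ltr_norml; apply/andP; split; lra.
  have [x /itvP xuv||c _] := @MVT_segment _ f (fun=> 0) u v uv.
  - by apply: fd; apply: xin; rewrite !xuv.
  - apply: continuous_in_subspaceT => x; rewrite inE /= => /itvP xuv.
    by apply: fc; apply: xin; rewrite !xuv.
  - by rewrite mul0r => /eqP; rewrite subr_eq0 => /eqP.
have o1 : `|0 : R| < 1 by rewrite normr0.
by have [z0|/ltW z0] := leP 0 z; [exact: fe|symmetry; exact: fe].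
Qed.

(** The differential equation [(1 - z) * y' = - a * y] on partial sums; the
    remainder is the boundary term of the shifted sum. *)
Lemma binc_ode a z n :
  (1 - z) * pseries (pseries_diffs (binc a)) z n =
  - a * pseries (binc a) z n - n%:R * binc a n * z ^+ n.
Proof.
elim: n => [|n IH]; first by rewrite /pseries /series /= !big_nil; ring.
rewrite /pseries !seriesSr -/(pseries _ _) -/(pseries _ _) mulrDr IH.
rewrite /pseries_diffs /= !bincS exprS; ring.
Qed.

(** By its differential equation, the sum of the series times [(1 - z) `^ (- a)]
    has derivative zero. *)
Lemma binomial_series a z : `|z| < 1 -> pseries (binc a) z @ \oo --> (1 - z) `^ a.
Proof.
move=> z1; have cb := binc_disc_bounded a; have db := disc_bounded_diffs cb.
have H' (x : R) : `|x| < 1 -> (1 - x) * limn (pseries (pseries_diffs (binc a)) x) =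
    - a * limn (pseries (binc a) x).
  move=> x1; have cd := disc_bounded_cvg db x1; have cc := disc_bounded_cvg cb x1.
  have r0 : (fun n => n%:R * binc a n * x ^+ n) @ \oo --> (0 : R).
    have d0 := cvg_series_cvg_0 cd.
    have : (fun n => x * (pseries_diffs (binc a) n * x ^+ n)) @ \oo --> x * 0.
      exact: cvgMl_tmp.
    rewrite mulr0 -(cvg_shiftS (fun n => n%:R * binc a n * x ^+ n)) /=.
    by under eq_fun do rewrite mulrCA -exprS.
  have lhs : (fun n => (1 - x) * pseries (pseries_diffs (binc a)) x n) @ \oo -->
      (1 - x) * limn (pseries (pseries_diffs (binc a)) x) by exact: cvgMl_tmp.
  have rhs : (fun n => (1 - x) * pseries (pseries_diffs (binc a)) x n) @ \oo -->
      - a * limn (pseries (binc a) x) - 0.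
    by under eq_fun do rewrite binc_ode; apply: cvgB => //; exact: cvgMl_tmp.
  by rewrite subr0 in rhs; rewrite -(cvg_lim _ lhs) // (cvg_lim _ rhs).
pose F x := limn (pseries (binc a) x) * (1 - x) `^ (- a).
have FE : F z = F 0.
  apply: disc_derive0_cst => // x x1.
  have x1' : 0 < 1 - x by move: x1; rewrite ltr_norml => /andP[_]; rewrite subr_gt0.
  have dH := disc_bounded_derive cb x1.
  have dl : is_derive x (1 : R) (fun y => 1 - y) (-1).
    have := is_deriveB (is_derive_cst (1 : R) x (1 : R)) (is_derive_id x (1 : R)).
    by rewrite sub0r.
  have dP : is_derive x (1 : R) (fun y => (1 - y) `^ (- a)) (a * (1 - x) `^ (- a - 1)).
    have := @is_derive1_comp R (fun y : R => y `^ (- a)) (fun y : R => 1 - y) x _ _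
       (@is_derive1_powR R (- a) (1 - x) x1') dl.
    by rewrite mulrN1 mulNr opprK.
  have := is_deriveM dH dP; rewrite /GRing.scale /=.
  set d := (X in is_derive _ _ _ X); suff -> : d = 0 by [].
  rewrite {}/d powRB ?powRr1 ?(ltW x1') //; last by rewrite (gt_eqF x1') implybT.
  have -> : limn (pseries (pseries_diffs (binc a)) x) =
      - a * limn (pseries (binc a) x) / (1 - x).
    by rewrite -H' // mulrAC mulfV ?mul1r // gt_eqF.
  by field; rewrite gt_eqF.
have z1' : 0 < 1 - z by move: z1; rewrite ltr_norml => /andP[_]; rewrite subr_gt0.
have F0 : F 0 = 1.
  rewrite /F subr0 powR1 mulr1; apply: cvg_lim => //.
  rewrite -cvg_shiftS.
  have -> : [sequence pseries (binc a) 0 n.+1]_n = (fun=> 1).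
    apply/funext => n /=; rewrite /pseries /series /= big_nat_recl // expr0 mulr1.
    by rewrite big1 ?addr0 // => i _; rewrite expr0n mulr0.
  exact: cvg_cst.
have Hz := disc_bounded_cvg cb z1.
suff -> : (1 - z) `^ a = limn (pseries (binc a) z) by [].
apply/esym; move: FE; rewrite F0 /F powRN => e.
by apply: (mulIf (_ : ((1 - z) `^ a)^-1 != 0));
  rewrite ?e ?mulfV ?invr_eq0 // gt_eqF // powR_gt0.
Qed.

End Binomial.

(** * Reciprocals of power series with log-convex coefficients *)

Section Kaluza.
Variables (R : realType) (m : nat -> R).
Hypothesis m_gt0 : forall n, 0 < m n.
Hypothesis m_logconvex : forall n, m n.+1 ^+ 2 <= m n * m n.+2.

Lemma logconvex_ratio j n : (j <= n)%N -> m n * m j.+1 <= m n.+1 * m j.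
Proof.
move=> /subnK <-; elim: (n - j)%N => [|k IH]; first by rewrite mulrC.
rewrite -(ler_pM2l (m_gt0 (k + j))) addSn.
have := ler_wpM2l (ltW (m_gt0 (k + j).+1)) IH.
have := ler_wpM2r (ltW (m_gt0 j)) (m_logconvex (k + j)); lra.
Qed.

Fixpoint recip_seq n : seq R :=
  if n is n'.+1 then
    rcons (recip_seq n')
      (- (\sum_(k < n) m (n - k) * (recip_seq n')`_k) / m 0)
  else [:: (m 0)^-1].

(** The coefficients of the reciprocal of [\sum_k m k * z ^+ k]. *)
Definition recip n := (recip_seq n)`_n.

Lemma size_recip_seq n : size (recip_seq n) = n.+1.
Proof. by elim: n => //= n IH; rewrite size_rcons IH. Qed.

Lemma nth_recip_seq n k : (k <= n)%N -> (recip_seq n)`_k = recip k.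
Proof.
elim: n => [|n IH]; first by rewrite leqn0 => /eqP->.
rewrite leq_eqVlt => /predU1P[-> //|kn].
by rewrite /= nth_rcons size_recip_seq kn IH.
Qed.

Lemma recip_convolution n : \sum_(k < n.+1) m (n - k) * recip k = (n == 0)%:R.
Proof.
case: n => [|n]; first by rewrite big_ord1 /recip /= mulfV // gt_eqF.
rewrite big_ord_recr subnn {2}/recip /= nth_rcons size_recip_seq ltnn eqxx.
under [in X in _ + X]eq_bigr => k _ do rewrite nth_recip_seq -1?ltnS //.
by rewrite mulrCA mulfV ?mulr1 ?subrr // gt_eqF.
Qed.

(** Kaluza: eliminating the term in [recip 0] between two consecutive convolution
    identities writes a positive multiple of [recip n.+1] as a combination of the
    earlier [recip k], [0 < k], with nonnegative coefficients. *)
Lemma recip_le0 n : recip n.+1 <= 0.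
Proof.
elim/ltn_ind: n => n IH.
have mm0 : 0 < m n * m 0 by rewrite mulr_gt0.
suff : m n * m 0 * recip n.+1 <= 0 by rewrite pmulr_rle0.
have -> : m n * m 0 * recip n.+1 =
    \sum_(k < n.+1) (m n.+1 * m (n - k) - m n * m (n.+1 - k)) * recip k
    - m n.+1 * (n == 0)%:R.
  have := recip_convolution n.+1; rewrite big_ord_recr subnn /= => /eqP.
  rewrite addrC addr_eq0 => /eqP e; rewrite -mulrA e -recip_convolution.
  rewrite !mulr_sumr mulrN mulr_sumr -sumrN -sumrB; apply: eq_bigr => k _; ring.
rewrite subr_le0; apply: le_trans (mulr_ge0 (ltW (m_gt0 _)) (ler0n _ _)).
apply: sumr_le0 => -[[|k] /= kn] _; first by rewrite !subn0 [m n * _]mulrC subrr mul0r.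
rewrite mulr_ge0_le0 ?IH // subr_ge0 subSS.
by rewrite -[(n - k)%N]prednK ?subn_gt0 // -subnS logconvex_ratio // leq_subr.
Qed.

Lemma recip0_gt0 : 0 < recip 0.
Proof. by rewrite /recip /= invr_gt0. Qed.

(** The product of the truncations of the two series to degree at most [N] is
    [1] up to degree [N]; the later coefficients are sums of a part of the terms
    of a vanishing convolution from which the only positive term is missing. *)
Lemma recip_truncation N z :
  `|pseries m z N.+1 * pseries recip z N.+1 - 1| <=
  recip 0 * \sum_(N.+1 <= n < N.+1 + N.+1) m n * `|z| ^+ n.
Proof.
pose P := \poly_(i < N.+1) m i; pose Q := \poly_(i < N.+1) recip i.
have -> : pseries m z N.+1 = P.[z] by rewrite horner_poly /pseries /series /= big_mkord.
have -> : pseries recip z N.+1 = Q.[z].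
  by rewrite horner_poly /pseries /series /= big_mkord.
have sPQ : (size (P * Q)%R <= N.+1 + N.+1)%N.
  apply: leq_trans (size_polyMleq _ _) _; apply: leq_trans (leq_pred _) _.
  by rewrite leq_add // size_poly.
rewrite -hornerM (horner_coef_wide _ sPQ) -(big_mkord xpredT (fun i => (P * Q)`_i * z ^+ i)).
rewrite (big_cat_nat _ (n := N.+1)) //= ?leq_addr //.
have low n : (n < N.+1)%N -> (P * Q)`_n = (n == 0)%:R.
  move=> nN; rewrite coefMr -recip_convolution; apply: eq_bigr => k _.
  by rewrite !coef_poly (leq_ltn_trans (leq_subr _ _)) // (leq_ltn_trans _ nN) // -ltnS.
have -> : \sum_(0 <= n < N.+1) (P * Q)`_n * z ^+ n = 1.
  rewrite big_nat_recl // low // mul1r expr0 big_nat big1 ?addr0 // => n /andP[_ nN].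
  by rewrite low // mul0r.
rewrite addrAC subrr add0r (le_trans (ler_norm_sum _ _ _)) // mulr_sumr !big_nat.
apply: ler_sum => n /andP[Nn _]; rewrite normrM normrX mulrA ler_wpM2r ?exprn_ge0 //.
have hi k : (k <= n)%N -> P`_(n - k) * Q`_k <= 0 /\
    m (n - k) * recip k - (k == 0)%:R * (recip 0 * m n) <= P`_(n - k) * Q`_k.
  case: k => [_|k kn].
    by rewrite subn0 [P`_n]coef_poly ltnNge Nn mul0r lexx mul1r mulrC subrr.
  have t0 : m (n - k.+1) * recip k.+1 <= 0 by rewrite pmulr_rle0 // recip_le0.
  rewrite mul0r subr0 !coef_poly; case: ifP => _; rewrite ?mul0r //.
  by case: ifP => _; rewrite ?mulr0.
rewrite coefMr ler_norml; apply/andP; split; last first.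
  apply: (@le_trans _ _ 0); last by rewrite mulr_ge0 ?ltW // recip0_gt0.
  by apply: sumr_le0 => -[k /= kn] _; exact: (proj1 (hi _ kn)).
apply: (@le_trans _ _ (\sum_(k < n.+1)
    (m (n - k) * recip k - (k == 0 :> nat)%:R * (recip 0 * m n)))).
  rewrite sumrB recip_convolution gtn_eqF ?(leq_ltn_trans _ Nn) // sub0r.
  by rewrite big_ord_recl /= mul1r big1 ?addr0 // => i _; rewrite mul0r.
by apply: ler_sum => -[k /= kn] _; exact: (proj2 (hi _ kn)).
Qed.

Lemma recip_cvg z (G : R) : disc_bounded m -> `|z| < 1 -> G != 0 ->
  pseries m z @ \oo --> G -> pseries recip z @ \oo --> G^-1.
Proof.
move=> mb z1 G0 mG.
pose A := series (fun n => m n * `|z| ^+ n).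
have Ac : cvgn A.
  have := disc_bounded_norm_cvg mb z1; rewrite /A.
  by under eq_fun do rewrite gtr0_norm //.
have And : nondecreasing_seq A.
  by apply/nondecreasing_series => n _ _; rewrite mulr_ge0 ?exprn_ge0 // ltW.
have PQ : (fun N => pseries m z N * pseries recip z N) @ \oo --> (1 : R).
  rewrite -(cvg_shiftS (fun N => pseries m z N * pseries recip z N)).
  apply/subr_cvg0/norm_cvg0P.
  apply: (@squeeze_cvgr _ _ _ _ (cst 0) (fun N => recip 0 * (limn A - A N.+1))).
  - apply: nearW => N /=; rewrite normr_ge0 (le_trans (recip_truncation _ _)) //.
    rewrite ler_pM2l ?recip0_gt0 // -sub_series_geq ?leq_addr // lerB //.
    exact: nondecreasing_cvgn_le.
  - exact: cvg_cst.
  - rewrite -(mulr0 (recip 0)) -(subrr (limn A)); apply: cvgMl_tmp.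
    apply: cvgB; first exact: cvg_cst.
    by rewrite (cvg_shiftS A).
have QE : {near \oo, (fun N => (pseries m z N * pseries recip z N) * (pseries m z N)^-1)
    =1 pseries recip z}.
  have : \forall N \near \oo, pseries m z N != 0.
    by apply: (cvgr_neq0 _ mG).
  by apply: filterS => N mN; rewrite mulrAC mulfV ?mul1r.
apply: cvg_trans (near_eq_cvg QE) _; rewrite -[G^-1]mul1r.
by apply: cvgM => //; exact: cvgV.
Qed.

End Kaluza.

(** * The radial profile *)

Section Profile.
Variable R : realType.
Implicit Types (r s t z T : R).

Definition gprof r t : R := if t == 1 then r else (1 - t `^ r) / (1 - t).

Lemma gprof_gt0 r t : 0 < r -> 0 <= t -> 0 < gprof r t.
Proof.
move=> r0 t0; rewrite /gprof; have [//|t1] := eqVneq t 1.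
have mono := gt0_ltr_powR r0; have one0 : (1 : R) \in Num.nneg by rewrite nnegrE.
have tn : t \in Num.nneg by rewrite nnegrE.
have [lt1|gt1] := ltP t 1.
  rewrite divr_gt0 ?subr_gt0 //; have := mono _ _ tn one0 lt1.
  by rewrite powR1.
have {}gt1 : 1 < t by rewrite lt_def t1.
rewrite -mulrNN -invrN !opprB divr_gt0 ?subr_gt0 //.
by have := mono _ _ one0 tn gt1; rewrite powR1.
Qed.

(** The absolute value makes an even function of the power, which is otherwise
    not continuous at [0]: by convention it is constantly one on the negative
    axis. *)
Lemma continuous_powR_norm r : 0 < r -> continuous (fun t => `|t| `^ r).
Proof.
move=> r0 t; have [->|t0] := eqVneq t 0.
  apply/cvgrPdist_lt => e e0.
  have near0 : \forall s \near (0 : R), `|s| < e `^ r^-1.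
    by apply: nbhs0_lt; rewrite powR_gt0.
  apply: filterS near0 => s es.
  rewrite normr0 powR0 ?gt_eqF // sub0r normrN ger0_norm ?powR_ge0 //.
  have -> : e = (e `^ r^-1) `^ r by rewrite -powRrM mulVf ?gt_eqF // powRr1 // ltW.
  by apply: (gt0_ltr_powR r0); rewrite ?nnegrE ?powR_ge0.
have t0' : 0 < `|t| by rewrite normr_gt0.
have d := @is_derive1_powR R r `|t| t0'.
have c : {for `|t|, continuous (fun s : R => s `^ r)}.
  by apply/differentiable_continuous/derivable1_diffP; apply: ex_derive.
apply: (@continuous_comp R R R Num.norm (fun s : R => s `^ r)) => //.
exact: norm_continuous.
Qed.

(** The quotient is the difference quotient of the power at [1], where its
    derivative is [r]. *)
Lemma gprof_continuous1 r : 0 < r -> {for 1, continuous (gprof r)}.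
Proof.
move=> r0; apply/continuous_withinNshiftx.
have [d] := @is_derive1_powR R r 1 ltr01.
rewrite powR1 mulr1 /derive => dr.
have -> : gprof r 1 = r by rewrite /gprof eqxx.
rewrite -[X in _ --> X]dr.
apply: cvg_trans d; apply: near_eq_cvg; near=> h.
have h0 : h != 0 by near: h; exact: nbhs_dnbhs_neq.
rewrite /= /gprof -subr_eq0 addrK (negPf h0) powR1 /GRing.scale /= mulr1.
by rewrite opprD addrCA subrr addr0 invrN mulrN -mulNr opprB mulrC.
Unshelve. all: by end_near. Qed.

Lemma gprof_norm_continuous r : 0 < r -> continuous (fun t => gprof r `|t|).
Proof.
move=> r0 t; have [t1|t1] := eqVneq `|t| 1.
  apply: (@continuous_comp R R R Num.norm (gprof r)); first exact: norm_continuous.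
  by rewrite t1; exact: gprof_continuous1.
have t1' : 1 - `|t| != 0 by rewrite subr_eq0 eq_sym.
have den : (fun s : R => 1 - `|s|) @ t --> 1 - `|t|.
  by apply: cvgB; [exact: cvg_cst|exact: norm_continuous].
have lim : (fun s => (1 - `|s| `^ r) / (1 - `|s|)) @ t --> (1 - `|t| `^ r) / (1 - `|t|).
  apply: cvgM; last exact: cvgV.
  by apply: cvgB; [exact: cvg_cst|exact: continuous_powR_norm].
rewrite /continuous_at [X in _ --> X]/gprof (negPf t1).
apply: cvg_trans lim; apply: near_eq_cvg.
apply: filterS (cvgr_neq0 _ den t1') => s.
by rewrite subr_eq0 eq_sym /gprof => /negPf->.
Qed.

End Profile.

(** * Difference quotients of the binomial series *)

Section Expansion.
Variables (R : realType) (r w : R).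
Hypotheses (r0 : 0 < r) (r1 : r < 1) (w0 : 0 < w) (w1 : w < 1).
Implicit Types (z : R).

(** [(1 - z) `^ r = 1 - \sum_k tailc k * z ^+ k.+1]. *)
Definition tailc k : R := - binc r k.+1.

Lemma tailcS k : tailc k.+1 = tailc k * (k.+1%:R - r) / k.+2%:R.
Proof. by rewrite /tailc bincE -!mulNr. Qed.

Lemma tailc_gt0 k : 0 < tailc k.
Proof.
elim: k => [|k IH]; first by rewrite /tailc bincE /binc mul1r sub0r divr1 opprK.
rewrite tailcS divr_gt0 ?mulr_gt0 // subr_gt0 (lt_le_trans r1) //.
by rewrite ler1n.
Qed.

Lemma tailc_le1 k : tailc k <= 1.
Proof.
elim: k => [|k IH]; first by rewrite /tailc bincE /binc mul1r sub0r divr1 opprK ltW.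
rewrite tailcS -mulrA mulr_ile1 ?(ltW (tailc_gt0 _)) //.
  by rewrite divr_ge0 // subr_ge0 (le_trans (ltW r1)) // ler1n.
rewrite ler_pdivrMr // mul1r lerBlDr -[k.+2%:R]natr1; have := r0; lra.
Qed.

Lemma tailc_logconvex k : tailc k.+1 ^+ 2 <= tailc k * tailc k.+2.
Proof.
have ratio : (k.+1%:R - r) / k.+2%:R <= (k.+2%:R - r) / k.+3%:R.
  rewrite ler_pdivrMr // mulrAC ler_pdivlMr // -[k.+3%:R]natr1 -[k.+2%:R]natr1.
  by rewrite -[k.+1%:R]natr1; have := r0; have := ler0n R k; nra.
have := ler_wpM2l (ltW (mulr_gt0 (tailc_gt0 k) (tailc_gt0 k.+1))) ratio.
have := tailcS k; have := tailcS k.+1; rewrite -!mulrA.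
set x := _ / k.+2%:R; set y := _ / k.+3%:R => -> e h; rewrite expr2 {1}e.
by have -> : tailc k * x * tailc k.+1 = tailc k * (tailc k.+1 * x) by ring.
Qed.

Lemma tailc_disc_bounded i : disc_bounded (fun j => tailc (i + j)).
Proof.
move=> s /andP[s0 s1]; exists 1 => n.
rewrite gtr0_norm ?tailc_gt0 // mulr_ile1 ?tailc_le1 ?(ltW (tailc_gt0 _)) //.
  by rewrite exprn_ge0 // ltW.
by rewrite exprn_ile1 // ltW.
Qed.

Lemma tailc_cvg z : `|z| < 1 ->
  series (fun k => tailc k * z ^+ k.+1) @ \oo --> 1 - (1 - z) `^ r.
Proof.
move=> z1; have := binomial_series (a := r) z1.
rewrite -(cvg_shiftS (pseries (binc r) z)) => b.
have -> : series (fun k => tailc k * z ^+ k.+1) = (fun n => 1 - pseries (binc r) z n.+1).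
  apply/funext => n; rewrite /pseries /series /= big_nat_recl //= expr0 mulr1.
  rewrite opprD addrA subrr add0r -sumrN; apply: eq_bigr => i _.
  by rewrite mulNr.
by apply: cvgB => //; exact: cvg_cst.
Qed.

(** The coefficients of the difference quotient at [w] of [1 - (1 - z) `^ r]. *)
Definition quotc i : R := limn (pseries (fun j => tailc (i + j)) w).

Lemma normw_lt1 : `|w| < 1. Proof. by rewrite gtr0_norm. Qed.

Lemma quotc_cvg i : pseries (fun j => tailc (i + j)) w @ \oo --> quotc i.
Proof. exact: (disc_bounded_cvg (tailc_disc_bounded i) normw_lt1). Qed.

Lemma quotc_rec i : quotc i = tailc i + w * quotc i.+1.
Proof.
apply: cvg_lim => //.
rewrite -(cvg_shiftS (pseries (fun j => tailc (i + j)) w)).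
have -> : [sequence pseries (fun j => tailc (i + j)) w n.+1]_n =
    (fun n => tailc i + w * pseries (fun j => tailc (i.+1 + j)) w n).
  apply/funext => n; rewrite /pseries /series /= big_nat_recl // addn0 expr0 mulr1.
  congr (_ + _); rewrite mulr_sumr; apply: eq_bigr => j _.
  by rewrite exprS addnS mulrCA.
apply: cvgD; first exact: cvg_cst.
by apply: cvgMl_tmp; exact: quotc_cvg.
Qed.

Lemma quotc_ge0 i : 0 <= quotc i.
Proof.
apply: (cvgr_to_ge (@quotc_cvg i)); apply: nearW => n; apply: sumr_ge0 => j _.
by rewrite mulr_ge0 ?exprn_ge0 ?(ltW (tailc_gt0 _)) // ltW.
Qed.

Lemma quotc_gt0 i : 0 < quotc i.
Proof.
by rewrite quotc_rec ltr_pwDl ?tailc_gt0 // mulr_ge0 ?quotc_ge0 // ltW.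
Qed.

Lemma quotc_bounded i : quotc i <= (1 - w)^-1.
Proof.
have g : series (geometric 1 w) @ \oo --> (1 - w)^-1.
  by rewrite -[X in _ --> X]mul1r; apply: cvg_geometric_series; exact: normw_lt1.
apply: (ler_cvg_to (@quotc_cvg i) g); apply: nearW => n; apply: ler_sum => j _.
by rewrite ler_wpM2r ?exprn_ge0 ?tailc_le1 // ltW.
Qed.

Lemma quotc_disc_bounded : disc_bounded quotc.
Proof.
move=> s /andP[s0 s1]; exists (1 - w)^-1 => n.
rewrite gtr0_norm ?quotc_gt0 //; apply: le_trans (quotc_bounded n).
by rewrite ler_piMr ?quotc_ge0 // exprn_ile1 // ltW.
Qed.

(** [quotc i / tailc i] is the sum over [j] of [tailc (i + j) / tailc i * w ^+ j],
    increasing in [i] because [tailc] is log-convex; the recursion turns this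
    into the log-convexity of [quotc]. *)
Lemma quotc_logconvex i : quotc i.+1 ^+ 2 <= quotc i * quotc i.+2.
Proof.
have mono : quotc i * tailc i.+1 <= quotc i.+1 * tailc i.
  have c1 : (fun n => pseries (fun j => tailc (i + j)) w n * tailc i.+1) @ \oo -->
      quotc i * tailc i.+1 by apply: cvgMr_tmp; exact: quotc_cvg.
  have c2 : (fun n => pseries (fun j => tailc (i.+1 + j)) w n * tailc i) @ \oo -->
      quotc i.+1 * tailc i by apply: cvgMr_tmp; exact: quotc_cvg.
  apply: (ler_cvg_to c1 c2); apply: nearW => n.
  rewrite /pseries /series /= !mulr_suml; apply: ler_sum => j _.
  rewrite ![_ * w ^+ j]mulrC -!mulrA ler_wpM2l ?exprn_ge0 ?(ltW w0) // addSn.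
  exact: (logconvex_ratio tailc_gt0 tailc_logconvex (leq_addr _ _)).
have ti k : tailc k = quotc k - w * quotc k.+1 by rewrite {1}quotc_rec addrK.
by move: mono; rewrite !ti => h; rewrite -(ler_pM2l w0); lra.
Qed.

(** The recursion [quotc i = tailc i + w * quotc i.+1] makes the product with
    [z - w] telescope. *)
Lemma quotc_partial z N :
  (z - w) * pseries quotc z N =
  series (fun k => tailc k * z ^+ k.+1) N - w * quotc 0 + w * quotc N * z ^+ N.
Proof.
elim: N => [|N IH].
  by rewrite /pseries /series /= !big_nil expr0; ring.
rewrite /pseries !seriesSr -/(pseries _ _) mulrDr IH /= !exprS.
by rewrite [in w * quotc N](quotc_rec N); rewrite [in (z - w) * _](quotc_rec N); ring.
Qed.

Lemma quotc0 : w * quotc 0 = 1 - (1 - w) `^ r.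
Proof.
symmetry; apply: cvg_unique (tailc_cvg normw_lt1) _ => //.
have -> : series (fun k => tailc k * w ^+ k.+1) =
    (fun n => w * pseries (fun j => tailc (0 + j)) w n).
  apply/funext => n; rewrite /pseries /series /= mulr_sumr; apply: eq_bigr => j _.
  by rewrite exprS mulrCA.
by apply: cvgMl_tmp; exact: quotc_cvg.
Qed.

Lemma quotc_series z : `|z| < 1 -> z != w ->
  pseries quotc z @ \oo --> ((1 - w) `^ r - (1 - z) `^ r) / (z - w).
Proof.
move=> z1 zw; have zw0 : z - w != 0 by rewrite subr_eq0.
have -> : pseries quotc z = (fun N => (z - w) * pseries quotc z N / (z - w)).
  by apply/funext => N; rewrite mulrAC mulfV ?mul1r.
apply: cvgMr_tmp; under eq_fun do rewrite quotc_partial.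
have -> : (1 - w) `^ r - (1 - z) `^ r = 1 - (1 - z) `^ r - w * quotc 0 + w * 0.
  by rewrite quotc0; ring.
apply: cvgD; first by apply: cvgB; [exact: tailc_cvg|exact: cvg_cst].
under eq_fun do rewrite -mulrA; apply: cvgMl_tmp.
apply: cvg_series_cvg_0; apply: (disc_bounded_cvg quotc_disc_bounded z1).
Qed.

End Expansion.

(** * Bernstein expansions of the profile and of powers *)

Section ProfileBernstein.
Variable R : realType.
Implicit Types (r z T : R).

(** Off [z = 1 - T^-1], which is [t = 1], this is the closed form of the difference
    quotient; at this point both sides are continuous. *)
Lemma quotc_series_gprof r T z : 0 < r -> r < 1 -> 1 < T -> `|z| < 1 ->
  pseries (quotc r (1 - T^-1)) z @ \oo --> T / T `^ r * gprof r (T * (1 - z)).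
Proof.
move=> r0 r1 T1 z1; have T0 : 0 < T by apply: lt_trans T1.
set w := 1 - T^-1; have w0 : 0 < w by rewrite subr_gt0 invf_lt1.
have w1 : w < 1 by rewrite gtrBl invr_gt0.
have lt_w (x : R) : `|x| < 1 -> 0 < 1 - x.
  by rewrite ltr_norml => /andP[_]; rewrite subr_gt0.
have off_w (x : R) : `|x| < 1 -> x != w ->
    pseries (quotc r w) x @ \oo --> T / T `^ r * gprof r (T * (1 - x)).
  move=> x1 xw; have := quotc_series r0 r1 w0 w1 x1 xw.
  have x0 := lt_w _ x1; have den : x - w != 0 by rewrite subr_eq0.
  have e : 1 - T * (1 - x) = T * (x - w) by rewrite /w; field; rewrite gt_eqF.
  have t1 : T * (1 - x) != 1.
    by rewrite eq_sym -subr_eq0 e mulf_neq0 // gt_eqF.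
  rewrite /gprof (negPf t1) e powRM ?(ltW T0) ?(ltW x0) // subKr.
  rewrite -powR_inv1 ?(ltW T0) // -powRrM mulN1r powRN.
  have p0 : T `^ r != 0 by rewrite gt_eqF // powR_gt0.
  set y := (1 - x) `^ r; suff -> : T / T `^ r * ((1 - T `^ r * y) / (T * (x - w))) =
    ((T `^ r)^-1 - y) / (x - w) by [].
  by field; rewrite den p0 gt_eqF.
have [->|] := eqVneq z w; last exact: off_w.
have nw1 : `|w| < 1 by rewrite gtr0_norm.
have qb := quotc_disc_bounded r0 r1 w0 w1.
pose h x := limn (pseries (quotc r w) x) - T / T `^ r * gprof r `|T * (1 - x)|.
have hc : {for w, continuous h}.
  apply: cvgB.
    have d := disc_bounded_derive qb nw1.
    by apply/differentiable_continuous/derivable1_diffP; apply: ex_derive.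
  apply: cvgMl_tmp.
  apply: (@continuous_comp R R R (fun x => T * (1 - x)) (fun t => gprof r `|t|)).
    by apply: cvgMl_tmp; apply: cvgB; [exact: cvg_cst|exact: cvg_id].
  exact: gprof_norm_continuous.
have h0 : h w = 0.
  have hw := (continuous_withinNx h w).1 hc.
  have h00 : h @ w^' --> (0 : R).
    have near0 : \forall x \near w^', 0 = h x.
      near=> x.
      have x1 : `|x| < 1.
        near: x; apply: cvg_within; apply: (cvgr_lt _ (@norm_continuous _ _ w)) => //.
      have xw : x != w by near: x; exact: nbhs_dnbhs_neq.
      rewrite /h (cvg_lim _ (off_w x x1 xw)) //.
      by rewrite [`|T * _|]ger0_norm ?subrr // mulr_ge0 ?ltW // lt_w.
    by apply: cvg_trans (near_eq_cvg near0) _; exact: cvg_cst.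
  exact: cvg_unique hw h00.
have := disc_bounded_cvg qb nw1; rewrite /h ger0_norm in h0.
  by move/eqP: h0; rewrite subr_eq0 => /eqP <-.
by rewrite mulr_ge0 ?ltW // lt_w.
Unshelve. all: by end_near. Qed.

Lemma gprof_bernstein r T : 0 < r -> r <= 1 -> 1 < T ->
  bernstein_at (fun t => (gprof r `|t|)^-1) T.
Proof.
move=> r0; rewrite le_eqVlt => /predU1P[->|r1] T1.
  (* For [r = 1] the profile is constant. *)
  exists (fun k => (k == 0)%:R); split=> // z z1.
  have -> : (gprof 1 `|T * (1 - z)|)^-1 = 1.
    rewrite /gprof; have [_|t1] := eqVneq `|T * (1 - z)| 1; first by rewrite invr1.
    by rewrite powRr1 // mulfV ?invr1 // subr_eq0 eq_sym.
  rewrite -(cvg_shiftS (series _)).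
  suff -> : [sequence series (fun k => (k == 0)%:R * z ^+ k) n.+1]_n = fun=> 1.
    exact: cvg_cst.
  apply/funext => n; rewrite /series /= big_nat_recl // mul1r.
  by rewrite big1 ?addr0 // => i _; rewrite mul0r.
have T0 : 0 < T by apply: lt_trans T1.
have w0 : 0 < 1 - T^-1 by rewrite subr_gt0 invf_lt1.
have w1 : 1 - T^-1 < 1 by rewrite gtrBl invr_gt0.
have c0 : 0 < T / T `^ r by rewrite divr_gt0 // powR_gt0.
pose m := quotc r (1 - T^-1).
have m0 : forall n, 0 < m n := quotc_gt0 r0 r1 w0 w1.
have mlc := quotc_logconvex r0 r1 w0 w1.
exists (fun k => T / T `^ r * recip m k); split=> [k|z z1].
  by rewrite pmulr_rle0 //; exact: recip_le0.
have t0 : 0 <= T * (1 - z).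
  by rewrite mulr_ge0 ?(ltW T0) // subr_ge0 ler_normlW // ltW.
have mG := quotc_series_gprof r0 r1 T1 z1.
have G0 := gprof_gt0 r0 t0.
have := recip_cvg m0 mlc (quotc_disc_bounded r0 r1 w0 w1) z1 _ mG.
rewrite mulf_neq0 ?gt_eqF // => /(_ isT) c.
have -> : (fun k => T / T `^ r * recip m k * z ^+ k) =
    (fun k => T / T `^ r * (recip m k * z ^+ k)) by apply/funext => k; rewrite mulrA.
have -> : series (fun k => T / T `^ r * (recip m k * z ^+ k)) =
    (fun n => T / T `^ r * pseries (recip m) z n).
  by apply/funext => n; rewrite /pseries /series /= mulr_sumr.
have -> : (gprof r `|T * (1 - z)|)^-1 =
    T / T `^ r * (T / T `^ r * gprof r (T * (1 - z)))^-1.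
  by rewrite ger0_norm // invfM mulrA mulfV ?mul1r // gt_eqF.
exact: cvgMl_tmp.
Qed.

Lemma powR_bernstein r T : 0 < r -> r <= 1 -> 0 < T ->
  bernstein_at (fun t => `|t| `^ r) T.
Proof.
move=> r0 r1 T0; exists (fun k => T `^ r * binc r k); split=> [k|z z1].
  rewrite pmulr_rle0 ?powR_gt0 // -oppr_ge0 -/(tailc r k).
  elim: k => [|k IH]; first by rewrite /tailc bincE /binc mul1r sub0r divr1 opprK ltW.
  by rewrite tailcS divr_ge0 ?mulr_ge0 // subr_ge0 (le_trans r1) // ler1n.
have z0 : 0 <= 1 - z by rewrite subr_ge0 ler_normlW // ltW.
have -> : series (fun k => T `^ r * binc r k * z ^+ k) =
    (fun n => T `^ r * pseries (binc r) z n).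
  apply/funext => n; rewrite /pseries /series /= mulr_sumr.
  by apply: eq_bigr => k _; rewrite mulrA.
rewrite ger0_norm ?mulr_ge0 ?(ltW T0) // powRM ?(ltW T0) //.
by apply: cvgMl_tmp; exact: binomial_series.
Qed.

End ProfileBernstein.

(** * From kernels to functions on the Euclidean space *)

Section NegativePower.
Variables (R : realType) (I : finType).

(** With [c = D i0 i0], conditional negative definiteness at [v] minus a multiple of
    the basis vector at [i0] makes [D i i0 * D j i0 - c * D i j] positive
    semidefinite. Hence [D] is diagonally congruent to [1 - E] with [E] positive
    semidefinite, and [(1 - z) `^ (- a)] has nonnegative coefficients. *)
Lemma psd_powRN (D : I -> I -> R) (i0 : I) (a : R) :
  cnd_kernel D -> (forall i j, 0 < D i j) -> 0 < a ->
  psd_kernel (fun i j => D i j `^ (- a)).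
Proof.
move=> [Ds Dn] D0 a0; split=> [i j|v]; first by rewrite Ds.
pose c := D i0 i0; have c0 : 0 < c by exact: D0.
pose E i j := 1 - c * D i j / (D i i0 * D j i0).
have Dn0 i j : D i j != 0 by rewrite gt_eqF.
have Ep : psd_kernel E.
  split=> [i j|u]; first by rewrite /E Ds [D i i0 * _]mulrC.
  pose y i := (D i i0)^-1 * u i.
  rewrite (@eq_qform _ _ _ (fun i j => (D i i0)^-1 * (D j i0)^-1 *
    (D i i0 * D j i0 + (- c) * D i j))); last first.
    by move=> i j; rewrite /E; field; rewrite !Dn0.
  rewrite qform_diag qformD qformZ qform_rank1 -/y.
  have := Dn (fun i => y i + (- \sum_j y j) * (i == i0)%:R).
  rewrite qform_shift // big_split /= -mulr_sumr.
  under [X in _ + (- _) * X]eq_bigr do rewrite -[_%:R]mulr1.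
  rewrite (sum_delta i0 (fun=> 1)) mulr1 subrr => /(_ erefl).
  rewrite -/c; set s := \sum_j y j; set S := \sum_i y i * D i i0 => h.
  by have := sqr_ge0 (S - s * c); have := ler_wpM2l (ltW c0) h; nra.
have E1 i : E i i < 1 by rewrite gtrBl divr_gt0 ?mulr_gt0.
have bpos k : 0 <= binc (- a) k.
  elim: k => [|k IH]; first by rewrite /binc.
  by rewrite bincE opprK divr_ge0 ?mulr_ge0 // addr_ge0 // ltW.
rewrite (@eq_qform _ _ _ (fun i j => c^-1 `^ (- a) *
    (D i i0 `^ (- a) * D j i0 `^ (- a) * (1 - E i j) `^ (- a)))); last first.
  move=> i j; have -> : D i j = c^-1 * ((D i i0 * D j i0) * (1 - E i j)).
    by rewrite /E; field; rewrite !Dn0.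
  have e0 : 0 <= 1 - E i j by rewrite subKr divr_ge0 ?mulr_ge0 // ltW.
  by rewrite !powRM ?mulr_ge0 ?invr_ge0 // ltW.
rewrite qformZ qform_diag mulr_ge0 ?powR_ge0 //.
apply: (psd_series Ep bpos) => i j.
exact/binomial_series/psd_lt1.
Qed.

End NegativePower.

Section Euclidean.
Variable R : realType.

Lemma quad_formE m (A : 'M[R]_m) (v : 'cV[R]_m) :
  quad_form A v = qform (fun i j => A i j) (fun i => v i ord0).
Proof.
rewrite /quad_form mxE; apply: eq_bigr => i _; rewrite !mxE mulr_sumr.
by apply: eq_bigr => j _; ring.
Qed.

Lemma enorm_ge0 n (x : 'rV[R]_n) : 0 <= enorm x.
Proof. exact: sqrtr_ge0. Qed.

Lemma continuous_enorm n : continuous (@enorm R n).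
Proof.
move=> x; apply: (@continuous_comp _ R R (fun y : 'rV[R]_n => \sum_i y ord0 i ^+ 2) Num.sqrt).
  move: x; apply: continuous_big => [|i _ y]; first exact: add_continuous.
  apply: (@continuous_comp _ R R (fun z : 'rV[R]_n => z ord0 i) (fun t => t ^+ 2)).
    exact: coord_continuous.
  exact: exprn_continuous.
exact: sqrt_continuous.
Qed.

Lemma qform_sqr_diff (I : finType) (a : I -> R) (v : I -> R) : \sum_i v i = 0 ->
  qform (fun i j => (a i - a j) ^+ 2) v = - 2 * (\sum_i v i * a i) ^+ 2.
Proof.
move=> v0.
have sep (F : I -> R) : qform (fun i _ => F i) v = 0.
  rewrite /qform big1 // => i _; under eq_bigr do rewrite mulrAC.
  by rewrite -mulr_sumr v0 mulr0.
have sep' (F : I -> R) : qform (fun _ j => F j) v = 0.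
  by rewrite /qform exchange_big -[RHS](sep F); apply: eq_bigr => i _;
    apply: eq_bigr => j _; rewrite [v j * _]mulrC.
rewrite (@eq_qform _ _ _ (fun i j => (a i ^+ 2 + a j ^+ 2) + -2 * (a i * a j))).
  by rewrite !qformD qformZ qform_rank1 sep (sep' (fun j => a j ^+ 2)); ring.
by move=> i j; ring.
Qed.

(** The square root is a Bernstein function, and the squared distance is
    conditionally negative definite by expanding the squares. *)
Lemma cnd_enorm n m (x : 'I_m -> 'rV[R]_n) (i0 : 'I_m) :
  cnd_kernel (fun i j => enorm (x i - x j)).
Proof.
pose S i j := \sum_k (x i ord0 k - x j ord0 k) ^+ 2.
have S0 i j : 0 <= S i j by apply: sumr_ge0 => k _; exact: sqr_ge0.
have Sn : cnd_kernel S.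
  split=> [i j|v v0]; first by apply: eq_bigr => k _; rewrite -sqrrN opprB.
  rewrite (@qform_sum _ _ _ _ (fun k i j => (x i ord0 k - x j ord0 k) ^+ 2)).
  apply: sumr_le0 => k _; rewrite (qform_sqr_diff (fun i => x i ord0 k) v0).
  by rewrite mulNr oppr_le0 mulr_ge0 ?sqr_ge0.
have h0 : 0 < 2^-1 :> R by rewrite invr_gt0.
have h1 : 2^-1 <= 1 :> R by rewrite invf_le1 ?ler1n.
have E i j : enorm (x i - x j) = `|S i j| `^ 2^-1.
  rewrite ger0_norm // powR12_sqrt //; congr Num.sqrt.
  by apply: eq_bigr => k _; rewrite !mxE.
have [s q] := cnd_bernstein i0 (continuous_powR_norm h0)
  (fun T => powR_bernstein h0 h1) Sn S0.
by split=> [i j|v /q]; [rewrite !E s|under [in X in _ -> X]eq_qform do rewrite E].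
Qed.

Lemma f_quotE r n (x : 'rV[R]_n) : f_quot r x = (gprof r `|enorm x|)^-1.
Proof.
by rewrite ger0_norm ?enorm_ge0 // /f_quot /gprof; case: eqP; rewrite ?invf_div.
Qed.

Lemma g_quotE r n (x : 'rV[R]_n) : g_quot r x = gprof r `|enorm x|.
Proof. by rewrite ger0_norm ?enorm_ge0. Qed.

Lemma gprofV_norm_continuous (r : R) : 0 < r ->
  continuous (fun t : R => (gprof r `|t|)^-1).
Proof.
move=> r0 t; apply: cvgV; first by rewrite gt_eqF // gprof_gt0.
exact: gprof_norm_continuous.
Qed.

Lemma cnd_f_quot r n m (x : 'I_m -> 'rV[R]_n) (i0 : 'I_m) : 0 < r -> r <= 1 ->
  cnd_kernel (fun i j => f_quot r (x i - x j)).
Proof.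
move=> r0 r1.
have [s q] := cnd_bernstein i0 (gprofV_norm_continuous r0) (fun T => gprof_bernstein r0 r1)
  (cnd_enorm x i0) (fun i j => enorm_ge0 _).
by split=> [i j|v /q]; [rewrite !f_quotE s|under [in X in _ -> X]eq_qform do rewrite f_quotE].
Qed.

Lemma continuous_f_quot r n : 0 < r -> continuous (@f_quot R r n).
Proof.
move=> r0 x; rewrite /continuous_at f_quotE; under eq_cvg do rewrite f_quotE.
apply: (@continuous_comp _ R R (@enorm R n) (fun t => (gprof r `|t|)^-1)).
  exact: continuous_enorm.
exact: gprofV_norm_continuous.
Qed.

Lemma continuous_g_quot r n : 0 < r -> continuous (@g_quot R r n).
Proof.
move=> r0 x; rewrite /continuous_at g_quotE; under eq_cvg do rewrite g_quotE.
apply: (@continuous_comp _ R R (@enorm R n) (fun t => gprof r `|t|)).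
  exact: continuous_enorm.
exact: gprof_norm_continuous.
Qed.

Lemma g_quot_gt0 r n (x : 'rV[R]_n) : 0 < r -> 0 < g_quot r x.
Proof. by move=> r0; rewrite g_quotE gprof_gt0. Qed.

Lemma f_quotV r n (x : 'rV[R]_n) : f_quot r x = (g_quot r x)^-1.
Proof. by rewrite f_quotE g_quotE. Qed.

End Euclidean.

Theorem theorem1p1 (R : realType) (r : R) (hr0 : 0 < r) (hr1 : r <= 1) :
  (forall n : nat, (1 <= n)%N -> cond_negdef_fun (@f_quot R r n)) /\
  (forall n : nat, (1 <= n)%N -> infinitely_divisible (@g_quot R r n)).
Proof.
split=> n _.
  split=> [|m x m1]; first exact: continuous_f_quot.
  have [s q] := cnd_f_quot x (Ordinal m1) hr0 hr1.
  split=> [|v v0]; first by apply/matrixP => i j; rewrite !mxE s.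
  rewrite quad_formE (@eq_qform _ _ _ (fun i j => (-1) * f_quot r (x i - x j))).
    by rewrite qformZ mulN1r oppr_ge0 q.
  by move=> i j; rewrite !mxE mulN1r.
split=> [x|al al0]; first by rewrite ltW // g_quot_gt0.
split=> [x|m x m1].
  have g0 := g_quot_gt0 x hr0.
  have d := @is_derive1_powR R al _ g0.
  apply: (@continuous_comp _ R R (@g_quot R r n) (fun t => t `^ al)).
    exact: continuous_g_quot.
  by apply/differentiable_continuous/derivable1_diffP; apply: ex_derive.
have f0 i j : 0 < f_quot r (x i - x j) by rewrite f_quotV invr_gt0 g_quot_gt0.
have [s p] := psd_powRN (Ordinal m1) (cnd_f_quot x (Ordinal m1) hr0 hr1) f0 al0.
have E i j : g_quot r (x i - x j) `^ al = f_quot r (x i - x j) `^ (- al).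
  have g0 := g_quot_gt0 (x i - x j) hr0.
  by rewrite f_quotV -powR_inv1 ?(ltW g0) // -powRrM mulN1r opprK.
split=> [|v]; last first.
  rewrite quad_formE (@eq_qform _ _ _ (fun i j => f_quot r (x i - x j) `^ (- al))).
    exact: p.
  by move=> i j; rewrite mxE; exact: E.
apply/matrixP => i j; rewrite [LHS]mxE [LHS]mxE [RHS]mxE.
exact: etrans (E j i) (etrans (s j i) (esym (E i j))).
Qed.
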